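(* One has $\mathcal{L}^0\subseteq\mathcal{L}^1$; that is, for every $d\ge1$, every $\mathbb{Z}^d$-subshift belonging to $\mathcal{L}^0$ belongs to $\mathcal{L}^1$.
   Context: **Subshifts.** For $d\ge 1$ and a finite alphabet $A$, $A^{\mathbb{Z}^d}$ carries the product topology and the shift action $(\sigma^p x)(q)=x(p+q)$. A $\mathbb{Z}^d$-subshift is a closed set $X\subseteq A^{\mathbb{Z}^d}$ with $\sigma^p(X)=X$ for all $p\in\mathbb{Z}^d$. A subshift $Y$ is a factor of a subshift $X$ if there is a continuous surjective $f:X\to Y$ with $\sigma^p\circ f=f\circ\sigma^p$ for all $p$. A finite product of $\mathbb{Z}^d$-subshifts is viewed as a $\mathbb{Z}^d$-subshift over the product alphabet. **The class $\mathcal{L}^0$.** The basic $\mathbb{Z}^d$-subshifts are: the fullshifts $A^{\mathbb{Z}^d}$; the periodic shifts $A^{\mathbb{Z}^d/H}:=\{x\in A^{\mathbb{Z}^d}: x(p+h)=x(p)\ \forall p\in\mathbb{Z}^d,h\in H\}$ for $H$ a subgroup of $\mathbb{Z}^d$; the countable (possibly finite) subshifts. $\mathcal{L}^0_d$ is the smallest class of $\mathbb{Z}^d$-subshifts containing the basic subshifts and closed under finite products and factors; $\mathcal{L}^0=\bigsqcup_{d\ge1}\mathcal{L}^0_d$. **The class $\mathcal{L}^1$.** Let $E,F$ be countable sets and $A,B$ finite alphabets (finite sets). For a continuous $f:A^E\to B^F$, a position $q\in F$ is determined by $R\subseteq E$ if any $x,y\in A^E$ that coincide on $R$ satisfy $f(x)(q)=f(y)(q)$.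 $f$ is $r$-narrow ($r\in\mathbb{N}$) if each $q\in F$ is determined by a set of size at most $r$, and narrow if it is $r$-narrow for some $r$. A compact set $X\subseteq\Sigma^F$ ($\Sigma$ finite, $F$ countable) belongs to $\mathcal{L}^1$ if $X=\bigcup_{n\in\mathbb{N}}\mathrm{im}(f_n)$ where each $f_n:A_n^{\mathbb{N}}\to X$ is $r_n$-narrow for some finite alphabet $A_n$ and some $r_n\in\mathbb{N}$. *)

(* Defs.v *)
From mathcomp Require Import all_boot all_order all_algebra.
From mathcomp Require Import all_classical all_reals all_analysis.

Set Implicit Arguments.
Unset Strict Implicit.
Unset Printing Implicit Defensive.

Import GRing.Theory.
Local Open Scope classical_set_scope.
Local Open Scope ring_scope.

(* The space A^E; a finite alphabet is any finType, possibly empty. *)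
Notation config E A := (prod_topology (fun _ : E => discrete_topology A)).

Notation Zd d := 'rV[int]_d.

Definition translate d (A : finType) (p : Zd d) (x : config (Zd d) A) :
    config (Zd d) A :=
  fun q => x (p + q).

Definition subshift d (A : finType) (X : set (config (Zd d) A)) : Prop :=
  closed X /\ forall p : Zd d, translate p @` X = X.

(* [f] maps between the subspaces X and Y themselves, so it need not extend to
   the ambient configuration spaces.  As X is shift invariant, [x'] below ranges
   exactly over the shifts of [x]. *)
Definition factor_of d (A B : finType)
    (X : set (config (Zd d) A)) (Y : set (config (Zd d) B)) : Prop :=
  exists f : set_type X -> set_type Y,
    [/\ continuous f,
        (forall y, exists x, f x = y) &
        forall (p : Zd d) (x x' : set_type X),
          set_val x' = translate p (set_val x) ->
          set_val (f x') = translate p (set_val (f x))].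

Definition periodic_shift d (A : finType) (H : zmodClosed (Zd d)) :
    set (config (Zd d) A) :=
  [set x | forall p h : Zd d, h \in H -> x (p + h) = x p].

Definition product_shift d (I : finType) (A : I -> finType)
    (X : forall i, set (config (Zd d) (A i))) :
    set (config (Zd d) {dffun forall i, A i}) :=
  [set x | forall i, X i (fun p => (x p : {dffun forall i, A i}) i)].

Inductive L0 (d : nat) : forall A : finType, set (config (Zd d) A) -> Prop :=
| L0_fullshift (A : finType) : L0 [set: config (Zd d) A]
| L0_periodic (A : finType) (H : zmodClosed (Zd d)) :
    L0 (@periodic_shift d A H)
| L0_countable (A : finType) (X : set (config (Zd d) A)) :
    subshift X -> countable X -> L0 X
| L0_product (I : finType) (A : I -> finType)
    (X : forall i, set (config (Zd d) (A i))) :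
    (forall i, L0 (X i)) -> L0 (product_shift X)
| L0_factor (A B : finType)
    (X : set (config (Zd d) A)) (Y : set (config (Zd d) B)) :
    L0 X -> subshift Y -> factor_of X Y -> L0 Y.

Definition determined_by (E F : countType) (A B : finType)
    (f : config E A -> config F B) (q : F) (R : set E) : Prop :=
  forall x y : config E A, {in R, x =1 y} -> f x q = f y q.

Definition narrow (r : nat) (E F : countType) (A B : finType)
    (f : config E A -> config F B) : Prop :=
  continuous f /\
  forall q : F, exists R : set E, (R #<= `I_r)%card /\ determined_by f q R.

Definition L1 (F : countType) (S : finType) (X : set (config F S)) : Prop :=
  compact X /\
  exists (A : nat -> finType) (r : nat -> nat)
         (f : forall n, config nat (A n) -> config F S),
    (forall n, narrow (r n) (f n)) /\ X = \bigcup_n range (f n).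

(* Main.v *)
Require Import Defs.
From mathcomp Require Import all_boot all_order all_algebra.
From mathcomp Require Import all_classical all_reals all_analysis.

(* Every subshift in the class is closed, hence compact.  Full and periodic
   shifts are 1-narrow images: read each coordinate at a chosen representative
   of its coset.  Countable subshifts are countable unions of 0-narrow (constant)
   images.  For a product, combine the factors over all tuples of indices,
   of which there are countably many; the narrownesses add up.  A factor map is a
   sliding block code with a finite window W, by compactness, so composing it
   with an r-narrow map yields a |W|r-narrow map.  Continuity of narrow maps
   is automatic because each coordinate depends on finitely many coordinates. *)

Set Implicit Arguments.
Unset Strict Implicit.
Unset Printing Implicit Defensive.

Import GRing.Theory.
Local Open Scope classical_set_scope.
Local Open Scope ring_scope.

(** * Cylinders, closed sets and compactness in configuration spaces *)

Section Configurations.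
Variables (E : choiceType) (A : choiceType).
Implicit Types (x y : config E A) (s : seq E).

Lemma config_nbhsP x (U : set (config E A)) :
  nbhs x U <-> exists s, forall y, {in s, x =1 y} -> U y.
Proof.
split=> [|[s sU]].
  (* Convergence to [x] in the product topology is checked one coordinate at a time, so it suffices
     that the filter generated by the cylinders converges to [x]; a one-element list handles each
     coordinate. *)
  pose cyl (s : seq E) := [set y : config E A | {in s, x =1 y}].
  pose G := filter_from [set: seq E] cyl.
  have GF : Filter G.
    apply: filter_from_filter; first by exists [::].
    move=> s t _ _; exists (s ++ t) => // y st; split=> e es.
      by apply: st; rewrite mem_cat es.
    by apply: st; rewrite mem_cat es orbT.
  suff /[apply] : G --> x by move=> -[s _ sU]; exists s.
  apply/cvg_sup => e B -[C [[V oV <-] Ve VB]].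
  exists [:: e] => // y xy; apply: VB => /=.
  by rewrite -(xy e) ?inE.
apply: (@filterS _ _ _ [set y : config E A | {in s, x =1 y}]); first exact: sU.
elim: s {sU} => [|e s IHs]; first by apply: filterS filterT => y _ e; rewrite in_nil.
have xe : nbhs x [set y : config E A | x e = y e].
  have xe : nbhs (proj e x : discrete_topology A) [set x e].
    exact: (@discrete_set1 (discrete_topology A)).
  have cxe := @proj_continuous E (fun=> discrete_topology A) e x _ xe.
  by apply: (@filterS _ (nbhs x) _ (proj e @^-1` [set x e])) => // y; exact: esym.
apply: filterS (filterI xe IHs) => y [/= ye ys] e'.
by rewrite inE => /predU1P[->|/ys].
Qed.

Lemma config_closedP (X : set (config E A)) :
  closed X <-> forall x, (forall s, exists2 y, X y & {in s, x =1 y}) -> X x.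
Proof.
split=> [clX x approx|Xcl x clx].
  apply: clX => U /config_nbhsP[s sU].
  by have [y Xy sy] := approx s; exists y; split=> //; apply: sU.
apply: Xcl => s.
have [|y [Xy sy]] := clx [set y : config E A | {in s, x =1 y}].
  by apply/config_nbhsP; exists s.
by exists y.
Qed.

(* The compactness half of the Curtis-Hedlund-Lyndon theorem: stated on the
   subspace [X] because factor maps need not extend to the full space. *)
Lemma compact_window (X : set (config E A)) (B : Type) (h : set_type X -> B) :
  compact X -> (forall u, \forall v \near u, h v = h u) ->
  exists s, forall u v : set_type X, {in s, set_val u =1 set_val v} -> h u = h v.
Proof.
move=> /compact_near_coveringP cX hloc.
(* Near-covering compactness along the filter of ever larger windows: a window that works near each
   point of [X] yields a single one that works on all of [X]. *)
pose F := filter_from [set: seq E] (fun s => [set t : seq E | {subset s <= t}]).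
have FF : Filter F.
  apply: filter_from_filter; first by exists [::].
  move=> s t _ _; exists (s ++ t) => // u stu; split=> e es; apply: stu.
    by rewrite mem_cat es.
  by rewrite mem_cat es orbT.
pose P (t : seq E) x := forall x' y : set_type X,
  set_val x' = x -> {in t, x =1 set_val y} -> h x' = h y.
have [x Xx|s _ sP] := cX _ F P FF; last first.
  exists s => x y xy; apply: (sP s) xy => //.
  exact/set_mem/(valP x).
have [C [[V oV VC]]] := hloc (SigSub (mem_set Xx)); rewrite -VC /= => Vx VU.
have /config_nbhsP[s sV] : nbhs x V by apply: open_nbhs_nbhs.
have hs (y : set_type X) : {in s, x =1 set_val y} -> h y = h (SigSub (mem_set Xx)).
  by move=> sy; apply: VU; apply: sV.
exists ([set y : config E A | {in s, x =1 y}], [set t : seq E | {subset s <= t}]).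
  by split; [apply/config_nbhsP; exists s | exists s].
move=> [x' t] /= [sx' st] y' y y'E ty; rewrite !hs// => e es.
  by rewrite sx'// ty//; apply: st.
by rewrite y'E sx'.
Qed.

End Configurations.

Lemma config_setT_compact (E : choiceType) (A : finType) : compact [set: config E A].
Proof.
have := @tychonoff E (fun=> discrete_topology A) (fun=> setT).
rewrite (_ : [set f | _] = setT); last by apply/seteqP; split.
by apply=> _; apply/finite_compact/(@finite_finset A).
Qed.

Lemma closed_config_compact (E : choiceType) (A : finType) (X : set (config E A)) :
  closed X -> compact X.
Proof.
by move=> clX; apply: (@subclosed_compact _ X setT) => //; exact: config_setT_compact.
Qed.

(** * Narrow maps and countable unions of their images *)

Lemma seq_card_le (T : eqType) (s : seq T) (r : nat) :
  (size s <= r)%N -> ([set` s] #<= `I_r)%card.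
Proof.
move=> sr.
have sI : {homo index^~ s : e / [set` s] e >-> `I_r e}.
  by move=> e /= es; rewrite (leq_trans _ sr)// index_mem.
have inj : {in [set` s] &, injective (index^~ s)}.
  by move=> e e' /set_mem /= es /set_mem /= e's; exact: index_inj.
have [f fE] := Pinj inj; rewrite fE in sI.
by have [g _] := injPfun sI; exact: (inj_card_le g).
Qed.

(** Lists, possibly with repetitions, can be concatenated and their sizes added, which is how
    narrowness is bounded for products and factors. *)
Lemma narrow_seqP (E F : countType) (A B : finType) r (f : config E A -> config F B) :
  narrow r f <-> forall q, exists2 s : seq E, (size s <= r)%N &
    forall x y, {in s, x =1 y} -> f x q = f y q.
Proof.
split=> [[_ fr] q|fr].
  have [R [Rr Rf]] := fr q.
  have finR : finite_set R by apply/finite_set_leP; exists r.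
  exists (finmap.enum_fset (fset_set R)); first exact: geq_card_fset_set.
  move=> x y xy; apply: Rf => e Re; apply: xy.
  by rewrite -(in_fset_set finR) in Re.
split=> [x U /config_nbhsP[t tU]|q].
  apply/config_nbhsP.
  have [s sf] : exists s : seq E, forall y, {in s, x =1 y} -> {in t, f x =1 f y}.
    elim: t {tU} => [|q t [s sf]]; first by exists [::] => y _ q; rewrite in_nil.
    have [u _ uf] := fr q.
    exists (u ++ s) => y xy q'; rewrite inE => /predU1P[->|q't].
      by apply: uf => e eu; rewrite xy ?mem_cat ?eu.
    by apply: sf q't => e es; rewrite xy ?mem_cat ?es ?orbT.
  by exists s => y /sf /tU.
have [s sr sf] := fr q.
exists [set` s]; split; first exact: seq_card_le.
by move=> x y xy; apply: sf => e es; apply: xy; rewrite inE.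
Qed.

(* A countable index type may be empty; the indices coding no element of [J]
   are sent to the empty alphabet, whose configuration space is empty. *)
Lemma L1_countable_union (F : countType) (S : finType) (X : set (config F S))
    (J : countType) (A : J -> finType) (r : J -> nat)
    (f : forall j, config nat (A j) -> config F S) :
  compact X -> (forall j, narrow (r j) (f j)) -> X = \bigcup_j range (f j) ->
  L1 X.
Proof.
move=> cX fr XE; split=> //.
pose A' (o : option J) : finType := if o is Some j then A j else void.
pose r' (o : option J) := if o is Some j then r j else 0%N.
pose f' (o : option J) : config nat (A' o) -> config F S :=
  match o return config nat (A' o) -> config F S with
  | Some j => f j
  | None => fun x => match x 0%N : void with end
  end.
exists (A' \o unpickle), (r' \o unpickle), (fun n => f' (unpickle n)); split=> [n|].
  rewrite /=; case: (unpickle n) => [j|]; first exact: fr.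
  by apply/narrow_seqP => q; exists [::] => // x; case: (x 0%N : void).
rewrite XE; apply/seteqP; split=> x [].
  move=> j _ [z _ <-]; exists (pickle j) => //=.
  by rewrite pickleK; exists z.
move=> n _ /=; case: (unpickle n) => [j|] [z _ <-].
  by exists j => //; exists z.
by case: (z 0%N : void).
Qed.

(** * Subshifts and the basic cases *)

Section Shifts.
Variable d : nat.

Lemma translateD (A : finType) (p q : Zd d) (x : config (Zd d) A) :
  translate p (translate q x) = translate (p + q) x.
Proof. by apply/funext => t; rewrite /translate addrCA addrA. Qed.

Lemma translate0 (A : finType) (x : config (Zd d) A) : translate 0 x = x.
Proof. by apply/funext => t; rewrite /translate add0r. Qed.

Lemma subshiftP (A : finType) (X : set (config (Zd d) A)) :
  closed X -> (forall p x, X x -> X (translate p x)) -> subshift X.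
Proof.
move=> clX Xp; split=> // p; apply/seteqP; split=> [_ [x Xx <-]|x Xx].
  exact: Xp.
exists (translate (- p) x); first exact: Xp.
by rewrite translateD subrr translate0.
Qed.

Lemma subshift_translate (A : finType) (X : set (config (Zd d) A)) p x :
  subshift X -> X x -> X (translate p x).
Proof. by move=> [_ Xp] Xx; rewrite -(Xp p); exists x. Qed.

Lemma periodic_subshift (A : finType) (H : zmodClosed (Zd d)) :
  subshift (@periodic_shift d A H).
Proof.
apply: subshiftP => [|p x xH q h hH]; last by rewrite /translate addrA; exact: xH.
apply/config_closedP => x approx p h hH.
have [y yH xy] := approx [:: p + h; p].
by rewrite !xy ?inE ?eqxx ?orbT//; exact: yH.
Qed.

Lemma fullshift_subshift (A : finType) : subshift [set: config (Zd d) A].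
Proof. exact: subshiftP closedT _. Qed.

(** Precomposition with [rep] retracts the full shift onto [X], and it reads a single cell per
    position. Taking [rep] to be the identity gives full shifts, and coset representatives give
    periodic shifts. *)
Lemma retract_invariant_L1 (A : finType) (X : set (config (Zd d) A))
    (rep : Zd d -> Zd d) :
  closed X -> idempotent_fun rep -> X = [set x | forall p, x (rep p) = x p] -> L1 X.
Proof.
move=> clX repK XE.
pose f (x : config nat A) : config (Zd d) A := fun p => x (pickle (rep p)).
apply: (@L1_countable_union _ _ _ unit (fun=> A) (fun=> 1%N) (fun=> f)).
- exact: closed_config_compact.
- move=> _; apply/narrow_seqP => p; exists [:: pickle (rep p)] => // x y; apply.
  by rewrite inE.
rewrite XE; apply/seteqP; split=> [x xrep|_ [_ _ [x _ <-]] p].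
  (* The default [0] is harmless: only cells that code a position are ever read. *)
  exists tt => //; exists (fun n => x (odflt 0 (unpickle n))) => //.
  by apply/funext => p; rewrite /f pickleK /= xrep.
by rewrite /f -[rep (rep p)]/((rep \o rep) p) repK.
Qed.

Lemma fullshift_L1 (A : finType) : L1 [set: config (Zd d) A].
Proof.
by apply: (@retract_invariant_L1 _ _ id) closedT _ _ => //; apply/seteqP; split.
Qed.

Lemma periodic_L1 (A : finType) (H : zmodClosed (Zd d)) :
  L1 (@periodic_shift d A H).
Proof.
(* The choice depends only on the coset as a set, so positions congruent modulo [H] get the same
   representative. The default [0] never occurs, since [p] lies in its own coset. *)
pose rep (p : Zd d) : Zd d := xget 0 [set q | q - p \in H].
have repH p : rep p - p \in H.
  by rewrite /rep; case: xgetP => // /(_ p) /=; rewrite subrr rpred0.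
have repE p h : h \in H -> rep (p + h) = rep p.
  move=> hH; congr (xget 0 _); apply/funext => q; apply/propext.
  by rewrite /= opprD addrA rpredBr.
have clH := (periodic_subshift A H).1.
apply: (retract_invariant_L1 clH (rep := rep)).
  by move=> p /=; rewrite -{1}[rep p](addrNK p) addrC repE.
apply/seteqP; split=> x xH p; first by rewrite -[rep p](addrNK p) addrC xH.
by move=> h hH; rewrite -xH repE.
Qed.

Lemma countable_L1 (A : finType) (X : set (config (Zd d) A)) :
  closed X -> countable X -> L1 X.
Proof.
move=> clX /countable_injP[g ginj].
(* The image of [X] in [nat] is a countable index type, empty when [X] is. Each index carries one
   constant map. *)
pose J := {n : nat | `[< exists2 x, X x & g x = n >]}.
have pick (j : J) : exists2 x, X x & g x = val j by apply/asboolP; exact: valP j.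
pose x_ j := sval (cid2 (pick j)).
apply: (@L1_countable_union _ _ _ J (fun=> unit) (fun=> 0%N) (fun j _ => x_ j)).
- exact: closed_config_compact.
- by move=> j; apply/narrow_seqP => q; exists [::].
apply/seteqP; split=> [x Xx|_ [j _ [_ _ <-]]]; last first.
  by rewrite /x_; case: cid2.
have xJ : `[< exists2 y, X y & g y = g x >] by apply/asboolP; exists x.
exists (Sub (g x) xJ) => //; exists (fun=> tt) => //.
rewrite /x_; case: cid2 => y Xy /= gy.
by apply: ginj; rewrite ?inE.
Qed.

(** * Finite products *)

Lemma product_subshift (I : finType) (A : I -> finType)
    (X : forall i, set (config (Zd d) (A i))) :
  (forall i, subshift (X i)) -> subshift (product_shift X).
Proof.
move=> Xs; apply: subshiftP => [|p x xX i].
  apply/config_closedP => x approx i.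
  apply: (iffLR (config_closedP (X i)) (Xs i).1) => s.
  have [y yX xy] := approx s; exists (fun p => (y p : {dffun forall i, A i}) i) => //.
  by move=> p ps; rewrite xy.
exact: (subshift_translate p (Xs i) (xX i)).
Qed.

Lemma product_L1 (I : finType) (A : I -> finType)
    (X : forall i, set (config (Zd d) (A i))) :
  closed (product_shift X) -> (forall i, L1 (X i)) -> L1 (product_shift X).
Proof.
move=> clX XL1.
have Xi i : exists D : {A_ : nat -> finType &
    ((nat -> nat) * (forall n, config nat (A_ n) -> config (Zd d) (A i)))%type},
    (forall n, narrow ((projT2 D).1 n) ((projT2 D).2 n)) /\
    X i = \bigcup_n range ((projT2 D).2 n).
  by have [_ [B [r [f [fr XE]]]]] := XL1 i; exists (existT _ B (r, f)).
pose D i := sval (cid (Xi i)).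
have DP i := svalP (cid (Xi i)).
pose B i n := projT1 (D i) n.
pose f i n : config nat (B i n) -> config (Zd d) (A i) := (projT2 (D i)).2 n.
pose r i n := (projT2 (D i)).1 n.
have fr i n : narrow (r i n) (f i n) by exact: (DP i).1.
have XE i : X i = \bigcup_n range (f i n) by exact: (DP i).2.
(* One input over the product alphabet carries an input for every factor. Since [I] is finite, the
   tuples [j] form a countable type. *)
pose C (j : {ffun I -> nat}) : finType := {dffun forall i, B i (j i)}.
pose g (j : {ffun I -> nat}) (x : config nat (C j)) :
    config (Zd d) {dffun forall i, A i} :=
  fun p => [ffun i => f i (j i) (fun n => (x n : C j) i) p].
apply: (@L1_countable_union _ _ _ {ffun I -> nat} C
  (fun j => \sum_(i in I) r i (j i))%N g).
- exact: closed_config_compact.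
- move=> j; apply/narrow_seqP => q.
  have /choice[s sP] : forall i, exists s : seq nat, (size s <= r i (j i))%N /\
      forall x y, {in s, x =1 y} -> f i (j i) x q = f i (j i) y q.
    by move=> i; have /narrow_seqP/(_ q)[s ? ?] := fr i (j i); exists s.
  exists (flatten [seq s i | i <- enum I]).
    rewrite size_flatten /shape -map_comp sumnE big_map big_enum /=.
    by apply: leq_sum => i _; case: (sP i).
  move=> x y xy; apply/ffunP => i; rewrite !ffunE.
  apply: (sP i).2 => n ns /=; rewrite xy//.
  by apply/flatten_mapP; exists i; rewrite ?mem_enum.
apply/seteqP; split=> [x xX|_ [j _ [x _ <-]] i]; last first.
  rewrite XE; exists (j i) => //; exists (fun n => (x n : C j) i) => //.
  by apply/funext => p; rewrite ffunE.
have /choice[n nP] : forall i, exists n, exists z, f i n z = fun p => (x p : {dffun forall i, A i}) i.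
  by move=> i; have := xX i; rewrite XE => -[n _ [z _ zE]]; exists n, z.
(* The inputs are chosen only after [j] is fixed, so that their alphabets are literally [B i (j i)]
   and no cast from [B i (n i)] arises. *)
have [j zP] : exists j : {ffun I -> nat}, forall i, exists z,
    f i (j i) z = fun p => (x p : {dffun forall i, A i}) i.
  by exists [ffun i => n i] => i; rewrite ffunE.
pose z i := sval (cid (zP i)).
exists j => //; exists (fun m => [ffun i => z i m] : C j) => //.
apply/funext => p; apply/ffunP => i; rewrite ffunE.
rewrite [X in f i _ X](_ : _ = z i); last first.
  by apply/funext => m; exact: (ffunE (z^~ m)).
by rewrite /z; case: cid => /= ? ->.
Qed.

(** * Factors *)

Lemma factor_L1 (A B : finType) (X : set (config (Zd d) A)) (Y : set (config (Zd d) B)) :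
  subshift X -> subshift Y -> factor_of X Y -> L1 X -> L1 Y.
Proof.
move=> Xs [clY _] [f [fcont fsurj fshift]] [cX [C [r [g [gr XE]]]]].
(* The value of [f] at the origin is locally constant on [X], which gives the window of the block
   code. *)
have [w wP] : exists w : seq (Zd d), forall u v : set_type X,
    {in w, set_val u =1 set_val v} ->
    (set_val (f u) : config _ _) 0 = (set_val (f v) : config _ _) 0.
  apply: (@compact_window _ _ X _ (fun u => (set_val (f u) : config _ _) 0)) => // u.
  apply: (fcont u [set v | (set_val v : config _ _) 0 = (set_val (f u) : config _ _) 0]).
  apply: (@initial_continuous _ _ set_val (f u)
    [set y : config (Zd d) B | y 0 = (set_val (f u) : config _ _) 0]).
  by apply/config_nbhsP; exists [:: 0] => y ->; rewrite ?inE.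
have gX n z : X (g n z) by rewrite XE; exists n => //; exists z.
pose h n (z : config nat (C n)) : config (Zd d) B := set_val (f (SigSub (mem_set (gX n z)))).
apply: (@L1_countable_union _ _ _ nat C (fun n => size w * r n)%N h).
- exact: closed_config_compact.
- move=> n; apply/narrow_seqP => q.
  have /choice[s sP] : forall e, exists s : seq nat, (size s <= r n)%N /\
      forall x y, {in s, x =1 y} -> g n x (q + e) = g n y (q + e).
    by move=> e; have /narrow_seqP/(_ (q + e))[s ? ?] := gr n; exists s.
  exists (flatten [seq s e | e <- w]).
    rewrite size_flatten /shape -map_comp.
    elim: w {wP} => //= e w IHw; rewrite mulSn leq_add//.
    by case: (sP e).
  move=> x y xy.
  (* Equivariance moves position [q] to the origin, so the value at [q] depends only on [g n z] at
     the positions [q + e] with [e] in [w]. *)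
  have hE z : h n z q = (set_val (f (SigSub (mem_set
      (subshift_translate q Xs (gX n z))))) : config _ _) 0.
    by rewrite (fshift q (SigSub (mem_set (gX n z))))//= /translate addr0.
  rewrite !hE; apply: wP => e ew; rewrite /= /translate.
  apply: (sP e).2 => m ms; apply: xy.
  by apply/flatten_mapP; exists e.
apply/seteqP; split=> [y Yy|_ [n _ [z _ <-]]]; last exact/set_mem/valP.
have [u fu] := fsurj (SigSub (mem_set Yy)).
have [n _ [z _ gz]] : (\bigcup_n range (g n)) (set_val u).
  by rewrite -XE; exact/set_mem/valP.
exists n => //; exists z => //.
rewrite /h (_ : SigSub _ = u) ?fu//.
exact: val_inj.
Qed.

End Shifts.

Theorem proposition2p3 (d : nat) (d_ge1 : (1 <= d)%N) (A : finType)
    (X : set (config (Zd d) A)) :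
  L0 X -> L1 X.
Proof.
(* The induction must also carry the subshift property: products need closedness of their factors,
   and the factor case translates points inside [X]. *)
suff: L0 X -> subshift X /\ L1 X by move=> L01 /L01[].
elim=> {A X} [A|A H|A X Xs cX|I A X _ IH|A B X Y _ [Xs XL1] Ys fXY].
- by split; [exact: fullshift_subshift|exact: fullshift_L1].
- by split; [exact: periodic_subshift|exact: periodic_L1].
- by split=> //; apply: countable_L1; case: Xs.
- have Xs : subshift (product_shift X) by apply: product_subshift => i; case: (IH i).
  by split=> //; apply: product_L1 => [|i]; [case: Xs|case: (IH i)].
- by split=> //; apply: factor_L1 fXY XL1.
Qed.
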